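(* Let $\phi$ be an admissible potential with equilibrium state $\mu_\phi$, and let $C>0$ be a constant for which the Gaussian concentration bound holds for $\mu_\phi$. Then for all $n\ge 1$, all $1\le k\le n$ and all $u>0$, $$\mu_\phi\Big(x:\ \max_{a^{0,k-1}\in A^k}\big|\mathfrak{f}_n(x,a^{0,k-1})-\mu_\phi([a^{0,k-1}])\big|\ge\frac{(u+c\sqrt{k})\,\theta^{-k}}{\sqrt{n-k+1}}\Big)\le e^{-\frac{u^2}{4C}},$$ where $c=2\sqrt{2C\log|A|}$. Moreover, if $k=k(n)=\zeta\log n$ for some $\zeta>0$ (with $k(n)$ an integer, $1\le k(n)\le n$), then for all $u>0$ $$\mu_\phi\Big(x:\ \max_{a^{0,k(n)-1}\in A^{k(n)}}\big|\mathfrak{f}_n(x,a^{0,k(n)-1})-\mu_\phi([a^{0,k(n)-1}])\big|\ge\frac{(u+c'\sqrt{\log n})\,n^{\zeta|\log\theta|}}{\sqrt{n-k(n)+1}}\Big)\le e^{-\frac{u^2}{4C}},$$ where $c'=2\sqrt{2\zeta C\log|A|}$.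
   Context: $A$ is a finite alphabet, $\mathbb{N}=\{0,1,2,\dots\}$, $\Omega=A^{\mathbb{N}}$ with points $x=x^0x^1x^2\cdots$, and $T:\Omega\to\Omega$ is the shift $(Tx)^k=x^{k+1}$. Fix $\theta\in(0,1)$ and put $d_\theta(x,y)=\theta^{\inf\{k:\,x^k\ne y^k\}}$ (with $d_\theta(x,x)=0$). For $\phi:\Omega\to\mathbb{R}$ write $S_n\phi=\sum_{i=0}^{n-1}\phi\circ T^i$. For $x,y\in\Omega$ let $W(\phi,x,y)=\sup_{n\in\mathbb{N}}\sup_{a\in A^n}|S_n\phi(ax)-S_n\phi(ay)|$, and for $p\in\mathbb{N}$ let $W_p(\phi)=\sup\{W(\phi,x,y): x^i=y^i,\ 0\le i\le p-1\}$. A continuous $\phi$ satisfies Walters' condition if $\sup_{x,y}W(\phi,x,y)<\infty$ and $(W_p(\phi))_{p\in\mathbb{N}}$ is strictly positive and decreases to $0$. Such a $\phi$ has a unique equilibrium state $\mu_\phi$ (the unique shift-invariant probability measure maximizing $\nu\mapsto h(\nu)+\int\phi\,d\nu$, $h$ being the entropy). ''Admissible'' means: $\phi$ is continuous, satisfies Walters' condition, and one of: (1) $W_n(\phi)=O(\theta^n)$; (2) $W_n(\phi)=O(n^{-\alpha})$ for some $\alpha>1$; (3) $W_n(\phi)=O(\eta^{(\log n)^{\alpha}})$ for some $\eta\in(0,1)$, $\alpha>1$; (4) $W_n(\phi)=O(e^{-cn^{\alpha}})$ for some $c>0$, $\alpha\in(0,1)$. A function $K:\Omega^n\to\mathbb{R}$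 is separately $d_\theta$-Lipschitz if for every $i\in\{0,\dots,n-1\}$ there is a constant $\mathrm{Lip}_{\theta,i}(K)$ (taken to be the smallest one) such that $|K(x_0,\dots,x_i,\dots,x_{n-1})-K(x_0,\dots,x_i',\dots,x_{n-1})|\le \mathrm{Lip}_{\theta,i}(K)\,d_\theta(x_i,x_i')$ for all points of $\Omega$. The Gaussian concentration bound with constant $C$: for all $n\ge1$ and all separately $d_\theta$-Lipschitz $K:\Omega^n\to\mathbb{R}$, $\int e^{K(x,\dots,T^{n-1}x)}d\mu_\phi(x)\le \exp\big(\int K(x,\dots,T^{n-1}x)\,d\mu_\phi(x)\big)\exp\big(C\sum_{j=0}^{n-1}\mathrm{Lip}_{\theta,j}(K)^2\big)$. For admissible $\phi$ such a constant $C>0$ exists (main theorem of the paper). For a block $a^{0,k-1}=a^0\cdots a^{k-1}\in A^k$, the cylinder is $[a^{0,k-1}]=\{x\in\Omega: x^i=a^i,\ i=0,\dots,k-1\}$, and the empirical frequency is $\mathfrak{f}_n(x,a^{0,k-1})=\frac{1}{n-k+1}\sum_{j=0}^{n-k}\mathbf{1}_{[a^{0,k-1}]}(T^jx)$. *)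

(* Defs.v *)
From HB Require Import structures.
From mathcomp Require Import all_boot all_order all_algebra.
From mathcomp Require Import all_classical all_reals all_analysis.
Set Implicit Arguments.
Unset Strict Implicit.
Unset Printing Implicit Defensive.
Import Order.TTheory GRing.Theory Num.Theory.
Import numFieldNormedType.Exports.
Local Open Scope classical_set_scope.
Local Open Scope ring_scope.

(* A nonempty finite alphabet; the distinguished letter is only there because
   the library requires measurable spaces to be pointed. *)
#[short(type="alphabetType")]
HB.structure Definition Alphabet := {A of Pointed A & Finite A}.

Definition Omega (A : alphabetType) : Type :=
  prod_topology (fun _ : nat => discrete_topology A).

Section OmegaStructures.
Variable A : alphabetType.

HB.instance Definition _ := Topological.copy (Omega A)
  (prod_topology (fun _ : nat => discrete_topology A)).
HB.instance Definition _ := Pointed.copy (Omega A)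
  (prod_topology (fun _ : nat => discrete_topology A)).

HB.instance Definition _ := @isMeasurable.Build
  (sigma_display (@open (Omega A))) (Omega A) <<s @open (Omega A) >>
  (@sigma_algebra0 _ setT (@open (Omega A))) (@sigma_algebraC _ (@open (Omega A)))
  (@sigma_algebra_bigcup _ setT (@open (Omega A))).

End OmegaStructures.

Section Shift.
Variables (R : realType) (A : alphabetType).
Implicit Types (x y : Omega A) (phi : Omega A -> R) (theta : R).

Definition shift_map x : Omega A := fun k => x k.+1.

(* The distance d_theta; ex_minn is the least index of disagreement. *)
Definition dtheta theta x y : R :=
  if pselect (exists k, x k != y k) is left xy then theta ^+ ex_minn xy else 0.

Definition birkhoff phi (n : nat) x : R := \sum_(0 <= i < n) phi (iter i shift_map x).

(* Concatenation a x: the default value passed to nth is the letter of x read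
   beyond the end of a. *)
Definition prepend (n : nat) (a : n.-tuple A) x : Omega A :=
  fun k => nth (x (k - n)%N) a k.

Definition W phi x y : \bar R :=
  ereal_sup [set w | exists n (a : n.-tuple A),
    w = `|birkhoff phi n (prepend a x) - birkhoff phi n (prepend a y)|%:E].

Definition Wp phi (p : nat) : \bar R :=
  ereal_sup [set w | exists x y,
    (forall i, (i < p)%N -> x i = y i) /\ w = W phi x y].

Definition walters phi : Prop :=
  [/\ (ereal_sup [set w | exists x y, w = W phi x y] < +oo)%E,
      forall p, (0 < Wp phi p)%E,
      {homo Wp phi : p q / (p <= q)%N >-> (q <= p)%E}
    & Wp phi p @[p --> \oo] --> 0%E].

Definition admissible theta phi : Prop :=
  let w : nat -> R^o := fun n => fine (Wp phi n) in
  [/\ continuous phi, walters phi &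
    [\/ w =O_\oo (fun n => theta ^+ n : R^o),
        exists2 alpha : R, 1 < alpha &
          w =O_\oo (fun n => n%:R `^ (- alpha) : R^o),
        exists eta alpha : R, [/\ 0 < eta, eta < 1, 1 < alpha &
          w =O_\oo (fun n => eta `^ (ln n%:R `^ alpha) : R^o)]
      | exists c alpha : R, [/\ 0 < c, 0 < alpha, alpha < 1 &
          w =O_\oo (fun n => expR (- c * n%:R `^ alpha) : R^o)]]].

End Shift.

Section Equilibrium.
Variables (R : realType) (A : alphabetType).
Implicit Types (mu nu : probability (Omega A) R) (phi : Omega A -> R).

Definition shift_invariant nu : Prop :=
  forall B : set (Omega A), measurable B -> nu (@shift_map A @^-1` B) = nu B.

(* A finite partition of Omega into m (possibly empty) measurable pieces is
   given by the map P sending a point to the index of its piece. *)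
Definition measurable_partition (m : nat) (P : Omega A -> 'I_m) : Prop :=
  forall i, measurable (P @^-1` [set i]).

(* Shannon entropy of the join of the T^{-i} P for i < n; the convention
   0 log 0 = 0 holds automatically. *)
Definition join_entropy nu (m : nat) (P : Omega A -> 'I_m) (n : nat) : R :=
  - \sum_(s : n.-tuple 'I_m)
      let p := fine (nu [set x | forall i : 'I_n,
                               P (iter i (@shift_map A) x) = tnth s i]) in
      p * ln p.

(* The sequence below converges for every shift_map-invariant nu. *)
Definition partition_entropy nu (m : nat) (P : Omega A -> 'I_m) : R :=
  limn (fun n : nat => n%:R^-1 * join_entropy nu P n).

(* Kolmogorov-Sinai entropy, which the generator theorem would express through
   cylinders; the supremum here is over all finite measurable partitions. *)
Definition entropy nu : \bar R :=
  ereal_sup [set h | exists m (P : Omega A -> 'I_m),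
    measurable_partition P /\ h = (partition_entropy nu P)%:E].

Definition free_energy phi nu : \bar R :=
  (entropy nu + \int[nu]_x (phi x)%:E)%E.

Definition equilibrium_state phi mu : Prop :=
  shift_invariant mu /\
  forall nu, shift_invariant nu -> (free_energy phi nu <= free_energy phi mu)%E.

End Equilibrium.

Section Concentration.
Variables (R : realType) (A : alphabetType).
Implicit Types (theta : R) (mu : probability (Omega A) R).

Definition lipschitz_at theta (n : nat) (K : ('I_n -> Omega A) -> R) (i : 'I_n)
    (L : R) : Prop :=
  forall x y : 'I_n -> Omega A, (forall j, j != i -> x j = y j) ->
    `|K x - K y| <= L * dtheta theta (x i) (y i).

Definition separately_lipschitz theta (n : nat) (K : ('I_n -> Omega A) -> R) : Prop :=
  forall i, exists L, lipschitz_at theta K i L.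

(* The smallest Lipschitz constant: the infimum is attained as soon as the set
   is nonempty. *)
Definition Lip theta (n : nat) (K : ('I_n -> Omega A) -> R) (i : 'I_n) : R :=
  inf [set L | 0 <= L /\ lipschitz_at theta K i L].

Definition orbit_segment (n : nat) (x : Omega A) (i : 'I_n) : Omega A :=
  iter i (@shift_map A) x.

Definition gaussian_concentration theta mu (C : R) : Prop :=
  forall (n : nat) (K : ('I_n -> Omega A) -> R),
    (1 <= n)%N -> separately_lipschitz theta K ->
    (\int[mu]_x (expR (K (@orbit_segment n x)))%:E <=
     (expR (\int[mu]_x K (@orbit_segment n x))%R *
      expR (C * \sum_(j < n) Lip theta K j ^+ 2))%:E)%E.

End Concentration.

Section Frequencies.
Variables (R : realType) (A : alphabetType).

Definition cylinder (k : nat) (a : k.-tuple A) : set (Omega A) :=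
  [set x | forall i : 'I_k, x i = tnth a i].

(* For k <= n, the range j < (n - k).+1 is 0 <= j <= n - k. *)
Definition frequency (n k : nat) (x : Omega A) (a : k.-tuple A) : R :=
  (n - k).+1%:R^-1 *
  \sum_(0 <= j < (n - k).+1) \1_(cylinder a) (iter j (@shift_map A) x).

(* The terms are nonnegative, so starting from 0 does not change the maximum. *)
Definition max_deviation (mu : probability (Omega A) R) (n k : nat)
    (x : Omega A) : R :=
  \big[Num.max/0]_(a : k.-tuple A) `|frequency n x a - fine (mu (cylinder a))|.

End Frequencies.

(* Main.v *)
(** With N = n - k + 1, the indicator of a k-cylinder is theta^(-k)-Lipschitz,
    so the maximal deviation Z is a function of N points of the orbit, each
    with Lipschitz constant theta^(-k) / N, and its variance proxy is s^2 with
    s = theta^(-k) / sqrt N.  Concentration applied to r Z gives the Chernoff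
    bound P(Z >= E Z + u s) <= exp(- u^2 / (4 C)).  Concentration applied to
    the deviations of both signs of each single frequency, together with
    Jensen's inequality, gives r E Z <= ln (2 |A|^k) + C r^2 s^2; as
    2 <= |A|^k when |A| >= 2, optimizing over r yields E Z <= c sqrt k s.
    When |A| = 1, Z vanishes identically. *)

Require Import Defs.
From mathcomp Require Import all_boot all_order all_algebra.
From mathcomp Require Import all_classical all_reals all_analysis.
From mathcomp Require Import measurable_realfun lra ring.
Set Implicit Arguments.
Unset Strict Implicit.
Unset Printing Implicit Defensive.
Import Order.TTheory GRing.Theory Num.Theory.
Import numFieldNormedType.Exports.
Local Open Scope classical_set_scope.
Local Open Scope ring_scope.

(** * Bounded random variables: integrability, Jensen's inequality, Chernoff's bound *)

Lemma bounded_integrable d (T : measurableType d) (R : realType)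
    (mu : probability T R) (f : T -> R) (M : R) :
  measurable_fun setT f -> (forall x, `|f x| <= M) ->
  mu.-integrable setT (EFin \o f).
Proof.
move=> mf fM; apply: measurable_bounded_integrable => //.
  by rewrite [X in (X < _)%E](probability_setT mu) ltry.
exists M; split; first exact: num_real.
by move=> y My x _; apply: le_trans (fM x) (ltW My).
Qed.

Lemma bounded_expR_integrable d (T : measurableType d) (R : realType)
    (mu : probability T R) (f : T -> R) (M : R) :
  measurable_fun setT f -> (forall x, `|f x| <= M) ->
  mu.-integrable setT (EFin \o (expR \o f)).
Proof.
move=> mf fM; apply: (@bounded_integrable _ _ _ _ _ (expR M)).
  exact: measurableT_comp.
by move=> x /=; rewrite ger0_norm ?expR_ge0// ler_expR (le_trans (ler_norm _)).
Qed.

Lemma jensen_expR d (T : measurableType d) (R : realType)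
    (mu : probability T R) (f : T -> R) (M : R) :
  measurable_fun setT f -> (forall x, `|f x| <= M) ->
  expR (\int[mu]_x f x)%R <= (\int[mu]_x expR (f x))%R.
Proof.
move=> mf fM; set m := (\int[mu]_x f x)%R.
have If := bounded_integrable mu mf fM.
have Ic (r : R) : mu.-integrable setT (EFin \o cst r).
  by apply: (@bounded_integrable _ _ _ _ _ `|r|).
have cstE (r : R) : (\int[mu]_x (cst r) x)%R = r.
  by rewrite Rintegral_cst// [X in fine X](probability_setT mu) mulr1.
(* The tangent line to the exponential at the mean of f. *)
have tangent x : expR m * (f x + (cst (1 - m)) x) <= expR (f x).
  rewrite -[X in _ <= expR X](subrKC m) expRD ler_pM2l ?expR_gt0//.
  by rewrite /= addrCA; exact: expR_ge1Dx.
have Is : mu.-integrable setT (EFin \o (fun x => f x + (cst (1 - m)) x)).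
  exact: (integrableD measurableT If (Ic _)).
have -> : expR m = (\int[mu]_x (expR m * (f x + (cst (1 - m)) x)))%R.
  by rewrite RintegralZl// RintegralD// cstE subrKC mulr1.
apply: le_Rintegral => //.
- exact: (integrableZl measurableT _ Is).
- exact: (bounded_expR_integrable mu mf fM).
Qed.

(** Boundedness makes the moment generating function finite, so Chernoff's bound can be stated with
    a real-valued integral, ready to meet the concentration estimate. *)
Lemma exponential_markov d (T : measurableType d) (R : realType)
    (mu : probability T R) (f : T -> R) (M t r : R) :
  measurable_fun setT f -> (forall x, `|f x| <= M) -> 0 < r ->
  (mu [set x | (t <= f x)%R] <=
   ((\int[mu]_x expR (r * f x))%R * expR (- (r * t)))%:E)%E.
Proof.
move=> mf fM r0.
have Ie : mu.-integrable setT (EFin \o (expR \o (fun x => r * f x))).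
  apply: (@bounded_expR_integrable _ _ _ _ _ (r * M)).
    exact: measurable_funM.
  by move=> x; rewrite normrM gtr0_norm// ler_pM2l.
have := chernoff (mfun_Sub (mem_set mf) : {RV mu >-> R}) t r0.
rewrite EFinM fineK; last exact: (integrable_fin_num measurableT Ie).
rewrite /mmt_gen_fun unlock => /le_trans; apply.
by under eq_integral do rewrite /= mulrC.
Qed.

(** * Measurability of cylinders and of their shifted preimages *)

Section Coordinates.
Context {A : alphabetType}.

(** Singletons are open in the discrete alphabet and projections are continuous, so the set is open,
    hence Borel. *)
Lemma measurable_coordinate (m : nat) (b : A) :
  measurable [set x : Omega A | x m = b].
Proof.
apply: sub_sigma_algebra.
have coordinate_continuous :
    continuous (fun x : Omega A => x m : discrete_topology A).
  exact: (@proj_continuous nat (fun _ => discrete_topology A) m).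
exact: ((continuousP _).1 coordinate_continuous [set b] (discrete_open _)).
Qed.

Lemma iter_shift_map m (x : Omega A) i : iter m (@shift_map A) x i = x (i + m)%N.
Proof. by elim: m i => [|m IH] i /=; rewrite ?addn0// /shift_map IH addSnnS. Qed.

(** The preimage constrains only the coordinates [i + m] with [i < k]: a finite intersection of
    one-coordinate sets. *)
Lemma measurable_iter_cylinder (m k : nat) (a : k.-tuple A) :
  measurable (iter m (@shift_map A) @^-1` cylinder a).
Proof.
have -> : iter m (@shift_map A) @^-1` cylinder a =
    \bigcap_(i in [set: 'I_k]) [set x | x (i + m)%N = tnth a i].
  apply/seteqP; split=> x /= xa i; first by rewrite /= -iter_shift_map.
  by rewrite iter_shift_map; exact: xa.
apply: fin_bigcap_measurable => [|i _]; first exact: finite_finset.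
exact: measurable_coordinate.
Qed.

Lemma measurable_cylinder (k : nat) (a : k.-tuple A) : measurable (cylinder a).
Proof. exact: (measurable_iter_cylinder 0). Qed.

End Coordinates.

Lemma shift_invariant_iter_cylinder (R : realType) (A : alphabetType)
    (mu : probability (Omega A) R) (m k : nat) (a : k.-tuple A) :
  shift_invariant mu ->
  mu (iter m (@shift_map A) @^-1` cylinder a) = mu (cylinder a).
Proof.
move=> inv; elim: m => [//|m <-].
rewrite -[RHS]inv; last exact: measurable_iter_cylinder.
by congr (mu _); apply/seteqP; split=> x /=; rewrite -iterSr.
Qed.

(** * Lipschitz continuity of cylinder indicators *)

Section Metric.
Variables (R : realType) (A : alphabetType) (theta : R).
Hypotheses (theta_gt0 : 0 < theta) (theta_lt1 : theta < 1).

Lemma dtheta_ge0 (x y : Omega A) : 0 <= dtheta theta x y.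
Proof. by rewrite /dtheta; case: pselect => // p; rewrite exprn_ge0// ltW. Qed.

(** The least index of disagreement is at most [i], hence below [k], and powers of [theta]
    decrease. *)
Lemma dtheta_ge_expr k (x y : Omega A) (i : nat) :
  (i < k)%N -> x i != y i -> theta ^+ k <= dtheta theta x y.
Proof.
move=> ik xy; rewrite /dtheta; case: pselect => [p|[]]; last by exists i.
case: ex_minnP => m _ /(_ _ xy) mi.
by rewrite ler_wiXn2l ?ltW// (leq_trans mi)// ltnW.
Qed.

(** Points that agree on their first [k] letters lie in the same [k]-cylinders; otherwise their
    distance is at least [theta ^+ k], and the right-hand side is at least 1. *)
Lemma indic_cylinder_lipschitz k (a : k.-tuple A) (x y : Omega A) :
  `|\1_(cylinder a) x - \1_(cylinder a) y| <= theta ^- k * dtheta theta x y.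
Proof.
have tk : 0 < theta ^+ k by rewrite exprn_gt0.
have [/existsP[i xy]|/existsPn xy] := boolP [exists i : 'I_k, x i != y i].
  apply: (@le_trans _ _ 1).
    by rewrite !indicE; case: (_ \in _); case: (_ \in _);
      rewrite ?subrr ?subr0 ?sub0r ?normrN ?normr0 ?normr1.
  by rewrite -(mulVf (lt0r_neq0 tk)) ler_pM2l ?invr_gt0// (dtheta_ge_expr (ltn_ord i) xy).
have -> : \1_(cylinder a) x = \1_(cylinder a) y :> R.
  rewrite !indicE; congr (_%:R); congr (nat_of_bool _); apply/idP/idP;
    rewrite !inE => h i; have /negPn/eqP := xy i; first by move<-.
  by move->.
by rewrite subrr normr0 mulr_ge0 ?invr_ge0 ?dtheta_ge0// ltW.
Qed.

End Metric.

(** * Empirical frequencies as functions of [N] free points *)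

Section Empirical.
Variables (R : realType) (A : alphabetType).

(** The points need not form an orbit: the concentration hypothesis asks for functions on the whole
    of [Omega ^ N], evaluated on orbit segments only afterwards. *)
Definition empirical (N k : nat) (a : k.-tuple A) (x : 'I_N -> Omega A) : R :=
  N%:R^-1 * \sum_(j < N) \1_(cylinder a) (x j).

Definition max_empirical (mu : probability (Omega A) R) (N k : nat)
    (x : 'I_N -> Omega A) : R :=
  \big[Num.max/0]_(a : k.-tuple A) `|empirical a x - fine (mu (cylinder a))|.

Lemma frequencyE (n k : nat) (x : Omega A) (a : k.-tuple A) :
  frequency R n x a = empirical a (@orbit_segment A (n - k).+1 x).
Proof. by rewrite /frequency big_mkord. Qed.

Lemma max_deviationE mu (n k : nat) (x : Omega A) :
  max_deviation mu n k x = max_empirical mu k (@orbit_segment A (n - k).+1 x).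
Proof. by apply: eq_bigr => a _; rewrite frequencyE. Qed.

Lemma empirical_itv N k (a : k.-tuple A) (x : 'I_N.+1 -> Omega A) :
  0 <= empirical a x <= 1.
Proof.
rewrite mulr_ge0 ?invr_ge0 ?sumr_ge0//= ler_pdivrMl ?ltr0Sn// mulr1.
have -> : N.+1%:R = \sum_(j < N.+1) (1 : R) by rewrite sumr_const card_ord.
by apply: ler_sum => j _; rewrite indicE; case: (_ \in _).
Qed.

(** Moving one point changes a single term of the average. *)
Lemma empirical_lipschitz theta N k (a : k.-tuple A) (i : 'I_N) :
  0 < theta -> theta < 1 ->
  lipschitz_at theta (empirical a) i (theta ^- k / N%:R).
Proof.
move=> theta_gt0 theta_lt1 x y xy.
rewrite /empirical -mulrBr normrM ger0_norm ?invr_ge0//.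
rewrite [_ / _]mulrC -mulrA ler_wpM2l ?invr_ge0//.
rewrite -sumrB (bigD1 i)//= big1 ?addr0 => [|j /xy->]; last exact: subrr.
exact: indic_cylinder_lipschitz.
Qed.

(** A maximum of functions sharing a Lipschitz constant keeps that constant, so no factor counting
    the words appears. *)
Lemma max_empirical_lipschitz mu theta N k (i : 'I_N) :
  0 < theta -> theta < 1 ->
  lipschitz_at theta (max_empirical mu k) i (theta ^- k / N%:R).
Proof.
move=> theta_gt0 theta_lt1.
set L := theta ^- k / N%:R.
(* A one-sided bound is enough: exchanging [x] and [y] gives the other side, by symmetry of
   [dtheta]. *)
suff bound x y : (forall j, j != i -> x j = y j) ->
    max_empirical mu k x <= max_empirical mu k y + L * dtheta theta (x i) (y i).
  move=> x y xy; rewrite ler_norml.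
  have yx j : j != i -> y j = x j by move=> /xy.
  have dC : dtheta theta (y i) (x i) = dtheta theta (x i) (y i).
    rewrite /dtheta; case: pselect => p; case: pselect => q //.
    - by congr (_ ^+ _); apply: eq_ex_minn => j; rewrite eq_sym.
    - by case: q; case: p => j; exists j; rewrite eq_sym.
    - by case: p; case: q => j; exists j; rewrite eq_sym.
  by have := bound _ _ xy; have := bound _ _ yx; rewrite dC; lra.
move=> xy; have L0 : 0 <= L by rewrite mulr_ge0 ?invr_ge0// exprn_ge0// ltW.
apply: bigmax_le => [|a _].
  by rewrite addr_ge0// ?bigmax_ge_id// mulr_ge0// dtheta_ge0.
have := empirical_lipschitz a theta_gt0 theta_lt1 xy.
have := le_bigmax 0 (fun b : k.-tuple A =>
  `|empirical b y - fine (mu (cylinder b))|) a.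
rewrite -/(max_empirical mu k y) => my exy.
have := ler_normD (empirical a x - empirical a y)
  (empirical a y - fine (mu (cylinder a))).
by rewrite subrKA => /le_trans; apply; rewrite addrC lerD.
Qed.

Lemma max_empirical_le1 mu N k (x : 'I_N.+1 -> Omega A) :
  `|max_empirical mu k x| <= 1.
Proof.
rewrite ger0_norm ?bigmax_ge_id//; apply: bigmax_le => // a _.
have /andP[e0 e1] := empirical_itv a x.
have p0 : 0 <= fine (mu (cylinder a)) by rewrite fine_ge0.
have p1 : fine (mu (cylinder a)) <= 1.
  have mc := measurable_cylinder a.
  by rewrite -lee_fin fineK ?fin_num_measure// probability_le1.
by rewrite ler_norml; lra.
Qed.

Lemma measurable_empirical N k (a : k.-tuple A) :
  measurable_fun setT (fun x => empirical a (@orbit_segment A N x)).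
Proof.
rewrite /empirical; apply: measurable_funM; first exact: measurable_cst.
apply: (@measurable_sum _ _ _ _ _ _
  (fun j x => \1_(cylinder a) (@orbit_segment A N x j))) => j.
exact: (measurable_indic (measurable_iter_cylinder j a)).
Qed.

Lemma measurable_max_empirical mu N k :
  measurable_fun setT (fun x => max_empirical mu k (@orbit_segment A N x)).
Proof.
rewrite /max_empirical; elim: (index_enum _) => [|a s IH].
  by under eq_fun do rewrite big_nil; exact: measurable_cst.
under eq_fun do rewrite big_cons.
apply: measurable_maxr => //; apply: measurableT_comp => //.
by apply: measurable_funB => //; exact: measurable_empirical.
Qed.

(** By linearity the mean is an average of measures of shifted preimages of the cylinder, all equal
    by invariance. *)
Lemma mean_empirical (mu : probability (Omega A) R) N k (a : k.-tuple A) :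
  shift_invariant mu ->
  (\int[mu]_x empirical a (@orbit_segment A N.+1 x))%R = fine (mu (cylinder a)).
Proof.
move=> inv.
have mc j := @measurable_iter_cylinder A j k a.
have Ij (j : 'I_N.+1) : mu.-integrable setT
    (EFin \o (fun x => \1_(cylinder a) (@orbit_segment A N.+1 x j) : R)).
  apply: (@bounded_integrable _ _ _ _ _ 1); first exact: measurable_indic (mc j).
  by move=> x; rewrite indicE; case: (_ \in _); rewrite ?normr1 ?normr0.
have Is : mu.-integrable setT (EFin \o (fun x =>
    \sum_(j < N.+1) \1_(cylinder a) (@orbit_segment A N.+1 x j) : R)).
  have := integrable_sum measurableT (index_enum 'I_N.+1) (P := xpredT)
    (fun j _ => Ij j).
  by apply: eq_integrable => // x _ /=; rewrite sumEFin.
rewrite /empirical RintegralZl//.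
have -> : (\int[mu]_x (\sum_(j < N.+1) \1_(cylinder a) (@orbit_segment A N.+1 x j)))%R
    = \sum_(j < N.+1) fine (mu (cylinder a)).
  rewrite /Rintegral.
  under eq_integral do rewrite -sumEFin.
  rewrite integral_sum// -sum_fine; last first.
    by move=> j _; exact: (integrable_fin_num measurableT (Ij j)).
  apply: eq_bigr => j _; congr fine.
  have := integral_indic mu measurableT (mc j).
  by rewrite setIT [X in _ = X -> _]shift_invariant_iter_cylinder.
by rewrite sumr_const card_ord -(mulr_natl (fine _)) mulKf// pnatr_eq0.
Qed.

End Empirical.

(** * Exponential moments, mean and deviations of the maximum *)

Section Concentration.
Variables (R : realType) (A : alphabetType) (theta : R).
Variables (mu : probability (Omega A) R) (C : R).
Hypotheses (theta_gt0 : 0 < theta) (theta_lt1 : theta < 1).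
Hypotheses (C_gt0 : 0 < C) (gcb : gaussian_concentration theta mu C).

(** Concentration for [r * K], with [r] of either sign: the Lipschitz constants scale by [|r|], and
    the smallest ones are replaced by the common upper bound [L]. *)
Lemma gaussian_concentration_scaled N (K : ('I_N.+1 -> Omega A) -> R) (L M r : R) :
  0 <= L -> (forall i, lipschitz_at theta K i L) ->
  measurable_fun setT (fun x => K (@orbit_segment A N.+1 x)) ->
  (forall x, `|K x| <= M) ->
  (\int[mu]_x expR (r * K (@orbit_segment A N.+1 x)))%R <=
  expR (r * (\int[mu]_x K (@orbit_segment A N.+1 x))%R
        + C * r ^+ 2 * (N.+1%:R * L ^+ 2)).
Proof.
move=> L0 KL mK KM.
have rKL i : lipschitz_at theta (fun x => r * K x) i (`|r| * L).
  by move=> x y /KL; rewrite -mulrBr normrM -mulrA; exact: ler_wpM2l.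
have rL0 : 0 <= `|r| * L by rewrite mulr_ge0.
have Ie : mu.-integrable setT
    (EFin \o (expR \o (fun x => r * K (@orbit_segment A N.+1 x)))).
  apply: (@bounded_expR_integrable _ _ _ _ _ (`|r| * M)).
    by apply: measurable_funM => //; exact: measurable_cst.
  by move=> x; rewrite normrM ler_wpM2l.
have := gcb (ltn0Sn N) (fun i => ex_intro _ _ (rKL i)).
have IE := integrable_fin_num measurableT Ie.
rewrite -(fineK IE) lee_fin => /le_trans; apply.
rewrite RintegralZl//; last exact: bounded_integrable mK _.
rewrite -expRD ler_expR lerD2l -mulrA ler_pM2l//.
(* [Lip] is an infimum of nonnegative constants: it is at most any admissible one, and its
   nonnegativity allows squaring. *)
have LipL i : Lip theta (fun x => r * K x) i ^+ 2 <= (`|r| * L) ^+ 2.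
  have Lset : [set l | 0 <= l /\ lipschitz_at theta (fun x => r * K x) i l]
      (`|r| * L) by [].
  rewrite ler_sqr ?nnegrE//.
  - by apply: ge_inf => //; exists 0 => l [].
  - by apply: lb_le_inf => [|l []//]; exists (`|r| * L).
apply: (@le_trans _ _ (\sum_(j < N.+1) (`|r| * L) ^+ 2)).
  by apply: ler_sum => j _; exact: LipL.
by rewrite sumr_const card_ord exprMn real_normK ?num_real// -(mulr_natl (_ * _)) mulrCA.
Qed.

Hypothesis inv : shift_invariant mu.

(** Its square is the sum of the [N] squared Lipschitz constants [theta ^- k / N], as [scaleE]
    records. *)
Let scale (N k : nat) : R := theta ^- k / Num.sqrt N%:R.

Let scale_gt0 N k : 0 < scale N.+1 k.
Proof. by rewrite divr_gt0 ?invr_gt0 ?exprn_gt0// sqrtr_gt0. Qed.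

Let scaleE N k : N.+1%:R * (theta ^- k / N.+1%:R) ^+ 2 = scale N.+1 k ^+ 2.
Proof.
rewrite /scale; set q := Num.sqrt _; set t := theta ^- k.
have -> : N.+1%:R = q ^+ 2 by rewrite sqr_sqrtr.
by field; rewrite gt_eqF// sqrtr_gt0.
Qed.

Let lipschitz_ge0 N k : 0 <= theta ^- k / N.+1%:R.
Proof. by rewrite divr_ge0// invr_ge0 exprn_ge0// ltW. Qed.

(** Centring at the cylinder measure cancels the mean term, by invariance. The sign of [r] is free,
    so that absolute values can be treated later. *)
Lemma exp_moment_empirical N k (a : k.-tuple A) (r : R) :
  (\int[mu]_x expR (r * (empirical R a (@orbit_segment A N.+1 x)
                         - fine (mu (cylinder a)))))%R <=
  expR (C * r ^+ 2 * scale N.+1 k ^+ 2).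
Proof.
set m := fine _.
have bound (x : 'I_N.+1 -> Omega A) : `|empirical R a x - m| <= 1 + `|m|.
  rewrite (le_trans (ler_normB _ _))// lerD2r.
  by have /andP[e0 e1] := empirical_itv R a x; rewrite ger0_norm.
have Ie : mu.-integrable setT
    (EFin \o (fun x => empirical R a (@orbit_segment A N.+1 x) : R)).
  apply: (@bounded_integrable _ _ _ _ _ 1); first exact: measurable_empirical.
  move=> x; have /andP[e0 e1] := empirical_itv R a (@orbit_segment A N.+1 x).
  by rewrite ger0_norm.
have Ic : mu.-integrable setT (EFin \o (cst m : Omega A -> R)).
  by apply: (@bounded_integrable _ _ _ _ _ `|m|) => //; exact: measurable_cst.
have lip i : lipschitz_at theta (fun x : 'I_N.+1 -> Omega A => empirical R a x - m)
    i (theta ^- k / N.+1%:R).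
  move=> x y xy; rewrite opprB addrA subrK.
  exact: empirical_lipschitz xy.
have mf : measurable_fun setT
    (fun x => empirical R a (@orbit_segment A N.+1 x) - m).
  apply: measurable_funB; first exact: measurable_empirical.
  exact: measurable_cst.
have := gaussian_concentration_scaled r (lipschitz_ge0 N k) lip mf bound.
rewrite (RintegralB measurableT Ie Ic) mean_empirical// Rintegral_cst//.
by rewrite [X in m * fine X](probability_setT mu) mulr1 subrr mulr0 add0r scaleE.
Qed.

(** The exponential of the maximum is at most the sum of the exponentials over all words and both
    signs; each of these [2 * #|A| ^ k] terms has the Gaussian bound. *)
Lemma exp_moment_max_empirical N k (r : R) : 0 <= r ->
  (\int[mu]_x expR (r * max_empirical mu k (@orbit_segment A N.+1 x)))%R <=
  2 * #|A|%:R ^+ k * expR (C * r ^+ 2 * scale N.+1 k ^+ 2).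
Proof.
move=> r0.
pose dev (a : k.-tuple A) x : R :=
  empirical R a (@orbit_segment A N.+1 x) - fine (mu (cylinder a)).
pose total x : R := \sum_(a : k.-tuple A)
  (expR (r * dev a x) + expR (- r * dev a x)).
have term_ge a x : expR (r * `|dev a x|) <=
    expR (r * dev a x) + expR (- r * dev a x).
  by case: (ger0P (dev a x)) => _; rewrite ?mulrN ?mulNr ?lerDl ?lerDr expR_ge0.
have le_total a x : expR (r * `|dev a x|) <= total x.
  apply: le_trans (term_ge a x) _; rewrite /total (bigD1 a)//= lerDl.
  by apply: sumr_ge0 => b _; rewrite addr_ge0 ?expR_ge0.
have max_le x : expR (r * max_empirical mu k (@orbit_segment A N.+1 x)) <= total x.
  rewrite /max_empirical; elim/big_ind: _ => [|s t|a _]; last exact: le_total.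
  (* The initial value 0 of the maximum contributes 1, which is dominated by the term of any one
     word; the constant word at [point] serves. *)
  - rewrite mulr0 expR0; apply: le_trans (le_total [tuple of nseq k point] x).
    by rewrite -[X in X <= _]expR0 ler_expR mulr_ge0.
  - by rewrite maxEle; case: ifP.
have Ie (s : R) a : mu.-integrable setT
    (EFin \o (expR \o (fun x => s * dev a x))).
  apply: (@bounded_expR_integrable _ _ _ _ _ (`|s| * (1 + `|fine (mu (cylinder a))|))).
    apply: measurable_funM; first exact: measurable_cst.
    apply: measurable_funB; first exact: measurable_empirical.
    exact: measurable_cst.
  move=> x; rewrite normrM ler_wpM2l// (le_trans (ler_normB _ _))// lerD2r.
  have /andP[e0 e1] := empirical_itv R a (@orbit_segment A N.+1 x).
  by rewrite ger0_norm.
have It a : mu.-integrable setT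
    (EFin \o (fun x => expR (r * dev a x) + expR (- r * dev a x))).
  exact: (integrableD measurableT (Ie r a) (Ie (- r) a)).
have Itotal : mu.-integrable setT (EFin \o total).
  have := integrable_sum measurableT (index_enum (k.-tuple A)) (P := xpredT)
    (fun a _ => It a).
  by apply: eq_integrable => // x _ /=; rewrite sumEFin.
have totalE : (\int[mu]_x total x)%R = \sum_(a : k.-tuple A)
    (\int[mu]_x (expR (r * dev a x) + expR (- r * dev a x)))%R.
  rewrite /Rintegral.
  under eq_integral do rewrite -sumEFin.
  rewrite integral_sum// -sum_fine// => a _.
  exact: (integrable_fin_num measurableT (It a)).
apply: (@le_trans _ _ (\int[mu]_x total x)%R).
  apply: le_Rintegral => //.
  apply: (@bounded_expR_integrable _ _ _ _ _ r).
    by apply: measurable_funM; [exact: measurable_cst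
                               |exact: measurable_max_empirical].
  move=> x; rewrite normrM ger0_norm// -[X in _ <= X]mulr1.
  by rewrite ler_wpM2l// max_empirical_le1.
have -> : 2 * #|A|%:R ^+ k * expR (C * r ^+ 2 * scale N.+1 k ^+ 2) =
    \sum_(a : k.-tuple A) 2 * expR (C * r ^+ 2 * scale N.+1 k ^+ 2).
  by rewrite sumr_const card_tuple -(mulr_natr (_ * expR _)) natrX; ring.
rewrite totalE; apply: ler_sum => a _.
rewrite (RintegralD measurableT (Ie r a) (Ie (- r) a)).
rewrite mulr_natl mulr2n lerD//; first exact: exp_moment_empirical.
by rewrite -(sqrrN r); exact: exp_moment_empirical.
Qed.

Lemma max_empirical_integrable N k : mu.-integrable setT
  (EFin \o (fun x => max_empirical mu k (@orbit_segment A N.+1 x))).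
Proof.
apply: (@bounded_integrable _ _ _ _ _ 1); first exact: measurable_max_empirical.
by move=> x; exact: max_empirical_le1.
Qed.

(** Jensen's inequality turns the exponential moment into a bound on [r * m] for each [r > 0], and
    the best [r] is then chosen. *)
Lemma mean_max_empirical N k : (1 < #|A|)%N -> (0 < k)%N ->
  (\int[mu]_x max_empirical mu k (@orbit_segment A N.+1 x))%R <=
  2 * Num.sqrt (2 * C * ln #|A|%:R) * Num.sqrt k%:R * scale N.+1 k.
Proof.
move=> A1 k0; set m := (\int[mu]_x _)%R; set s := scale N.+1 k.
set w := Num.sqrt (2 * C * ln #|A|%:R) * Num.sqrt k%:R.
have s0 : 0 < s by exact: scale_gt0.
have lnA : 0 < ln #|A|%:R :> R by rewrite ln_gt0// ltr1n.
have kR : 0 < k%:R :> R by rewrite ltr0n.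
have w0 : 0 < w by rewrite mulr_gt0 ?sqrtr_gt0 ?mulr_gt0.
have w2 : w ^+ 2 = 2 * C * ln #|A|%:R * k%:R.
  by rewrite exprMn !sqr_sqrtr// ltW// !mulr_gt0.
(* The minimizer of w^2 / (C r) + C r s^2. *)
pose r := w / (C * s).
have r0 : 0 < r by rewrite divr_gt0// mulr_gt0.
have logbound : r * m <= 2 * ln #|A|%:R * k%:R + C * r ^+ 2 * s ^+ 2.
  rewrite -ler_expR.
  have -> : r * m =
      (\int[mu]_x (r * max_empirical mu k (@orbit_segment A N.+1 x)))%R.
    by rewrite RintegralZl//; exact: max_empirical_integrable.
  apply: le_trans (@jensen_expR _ _ _ mu _ r _ _) _.
  - by apply: measurable_funM; [exact: measurable_cst
                               |exact: measurable_max_empirical].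
  - move=> x; rewrite normrM gtr0_norm// -[X in _ <= X]mulr1.
    by rewrite ler_pM2l// max_empirical_le1.
  apply: le_trans (exp_moment_max_empirical N k (ltW r0)) _.
  rewrite expRD ler_pM2r ?expR_gt0//.
  have Ak : #|A|%:R ^+ k = expR (ln #|A|%:R * k%:R) :> R.
    by rewrite mulrC expRM_natl lnK// posrE ltr0n (ltn_trans _ A1).
  (* One copy of [ln #|A| * k] counts the words; the other pays for the factor 2, since
     [2 <= #|A| ^ k]. *)
  have -> : 2 * ln #|A|%:R * k%:R = ln #|A|%:R * k%:R + ln #|A|%:R * k%:R :> R.
    by ring.
  rewrite expRD -Ak ler_wpM2r ?exprn_ge0//.
  by rewrite -natrX ler_nat (leq_trans A1)// -{1}[#|A|]expn1 leq_pexp2l// ltnW.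
have -> : 2 * Num.sqrt (2 * C * ln #|A|%:R) * Num.sqrt k%:R * s = 2 * w * s.
  by rewrite /w !mulrA.
rewrite -(ler_pM2l r0); apply: le_trans logbound _.
have -> : 2 * ln #|A|%:R * k%:R = w ^+ 2 / C by rewrite w2; field; rewrite gt_eqF.
(* At this [r] both summands equal [w ^+ 2 / C], and so the bound is an equality. *)
rewrite le_eqVlt; apply/orP; left; apply/eqP; rewrite /r.
by field; rewrite !gt_eqF.
Qed.

Lemma max_empirical_deviation N k (u : R) : (1 < #|A|)%N -> (0 < k)%N -> 0 < u ->
  (mu [set x | ((u + 2 * Num.sqrt (2 * C * ln #|A|%:R) * Num.sqrt k%:R)
        * theta ^- k / Num.sqrt N.+1%:R
        <= max_empirical mu k (@orbit_segment A N.+1 x))%R]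
   <= (expR (- (u ^+ 2 / (4 * C))))%:E)%E.
Proof.
(* Here [c] includes the factor [sqrt k], so the threshold is [(u + c) * s]. *)
move=> A1 k0 u0; set c := 2 * _ * _; rewrite -mulrA -/(scale N.+1 k).
set s := scale N.+1 k; have s0 : 0 < s by exact: scale_gt0.
have mean : _ <= c * s := mean_max_empirical N A1 k0.
(* The minimizer of C r^2 s^2 - r u s. *)
pose r := u / (2 * C * s).
have r0 : 0 < r by rewrite divr_gt0// mulr_gt0// mulr_gt0.
have mM := @measurable_max_empirical R A mu N.+1 k.
apply: le_trans
  (exponential_markov mu ((u + c) * s) mM
     (fun x => max_empirical_le1 mu k (@orbit_segment A N.+1 x)) r0) _.
rewrite lee_fin.
have lip i : lipschitz_at theta (@max_empirical R A mu N.+1 k) i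
    (theta ^- k / N.+1%:R) by exact: max_empirical_lipschitz.
have := gaussian_concentration_scaled r (lipschitz_ge0 N k) lip mM
  (max_empirical_le1 mu k).
rewrite scaleE -/s => moment.
apply: le_trans (ler_wpM2r (expR_ge0 _) moment) _.
rewrite -expRD ler_expR.
(* Once the mean is replaced by its bound [c * s], the [c] terms cancel and [C r^2 s^2 - r u s]
   remains, equal to [- u^2 / (4 C)] at the chosen [r]. *)
apply: (@le_trans _ _ (r * (c * s) + C * r ^+ 2 * s ^+ 2 - r * ((u + c) * s))).
  by rewrite !lerD2r ler_pM2l.
rewrite le_eqVlt; apply/orP; left; apply/eqP; rewrite /r.
by field; rewrite !gt_eqF.
Qed.

End Concentration.

(** * The one-letter alphabet and the two deviation bounds *)

Lemma max_empirical_unary (R : realType) (A : alphabetType)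
    (mu : probability (Omega A) R) (N k : nat) (x : 'I_N.+1 -> Omega A) :
  (#|A| <= 1)%N -> max_empirical mu k x = 0.
Proof.
(* With one letter every cylinder is the whole space, so frequency and measure are both 1. *)
move=> A1; have cylT (a : k.-tuple A) : cylinder a = setT.
  apply/seteqP; split=> // y _ i.
  exact: (fintype_le1P A1).
apply/eqP; rewrite eq_le bigmax_ge_id andbT; apply: bigmax_le => // a _.
rewrite cylT [X in fine X](probability_setT mu) /empirical cylT.
under eq_bigr do rewrite indicT.
by rewrite sumr_const card_ord mulVf ?pnatr_eq0// subrr normr0.
Qed.

Unset Implicit Arguments.
Set Strict Implicit.
Set Printing Implicit Defensive.

Theorem theorem3p6 (R : realType) (A : alphabetType) (theta : R)
    (phi : Omega A -> R) (mu : probability (Omega A) R) (C : R)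
    (theta_gt0 : 0 < theta) (theta_lt1 : theta < 1)
    (adm_phi : admissible theta phi) (eq_mu : equilibrium_state phi mu)
    (C_gt0 : 0 < C) (gcb : gaussian_concentration theta mu C) :
  (forall (n k : nat) (u : R), (1 <= n)%N -> (1 <= k <= n)%N -> 0 < u ->
     let c := 2 * Num.sqrt (2 * C * ln #|A|%:R) in
     (mu [set x | ((u + c * Num.sqrt k%:R) * theta ^- k
                    / Num.sqrt (n - k + 1)%:R <= max_deviation mu n k x)%R]
       <= (expR (- (u ^+ 2 / (4 * C))))%:E)%E) /\
  (forall (zeta : R) (n k : nat) (u : R), 0 < zeta ->
     (1 <= n)%N -> (1 <= k <= n)%N -> k%:R = zeta * ln n%:R -> 0 < u ->
     let c' := 2 * Num.sqrt (2 * zeta * C * ln #|A|%:R) in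
     (mu [set x | ((u + c' * Num.sqrt (ln n%:R)) * n%:R `^ (zeta * `|ln theta|)
                    / Num.sqrt (n - k + 1)%:R <= max_deviation mu n k x)%R]
       <= (expR (- (u ^+ 2 / (4 * C))))%:E)%E).
Proof.
have [inv _] := eq_mu.
have deviation n k u : (1 <= n)%N -> (1 <= k <= n)%N -> 0 < u ->
    (mu [set x | ((u + 2 * Num.sqrt (2 * C * ln #|A|%:R) * Num.sqrt k%:R)
                   * theta ^- k
                   / Num.sqrt (n - k + 1)%:R <= max_deviation mu n k x)%R]
      <= (expR (- (u ^+ 2 / (4 * C))))%:E)%E.
  move=> _ /andP[k0 _] u0; rewrite addn1.
  under eq_set do rewrite max_deviationE.
  have [A1|A1] := ltnP 1 #|A|; first exact: max_empirical_deviation.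
  under eq_set do rewrite max_empirical_unary//.
  (* The threshold is positive because [u] is, so the vanishing deviation never reaches it. *)
  rewrite [X in mu X](_ : _ = set0) ?measure0 ?lee_fin ?expR_ge0//.
  rewrite -subset0 => x /=; apply/negP; rewrite -ltNge.
  by rewrite divr_gt0 ?sqrtr_gt0// mulr_gt0 ?invr_gt0 ?exprn_gt0//
    ltr_wpDr// !mulr_ge0.
split=> // zeta n k u zeta0 n1 kn kE u0; lazy zeta.
have n0 : 0 < n%:R :> R by rewrite ltr0n.
have lnt : ln theta < 0 by rewrite ln_lt0// theta_gt0.
(* Both sides are [exp (- k ln theta)], as [k = zeta ln n] and [ln theta < 0]. *)
have -> : n%:R `^ (zeta * `|ln theta|) = theta ^- k.
  rewrite /powR gt_eqF// ltr0_norm// mulrN mulNr mulrAC -kE expRN.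
  by rewrite expRM_natl lnK.
(* The factor [zeta] moves from one root to the other, turning [ln n] into [k]; the second bound is
   then the first. *)
have -> : 2 * Num.sqrt (2 * zeta * C * ln #|A|%:R) * Num.sqrt (ln n%:R) =
    2 * Num.sqrt (2 * C * ln #|A|%:R) * Num.sqrt k%:R.
  rewrite -!(mulrA 2 (Num.sqrt _)); congr (_ * _).
  have lnA : 0 <= ln #|A|%:R :> R.
    by rewrite ln_ge0// ler1n; apply/card_gt0P; exists point.
  rewrite -!sqrtrM ?mulr_ge0// ?ltW//.
  by congr Num.sqrt; rewrite kE; ring.
exact: deviation.
Qed.
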